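(* Let $m,n,k$ be positive integers and let $\tau=1^m\text{-}1^m\text{-}\cdots\text{-}1^m$ consist of $n$ runs of $m$ ones separated by $n-1$ dashes. Let $A$ be the set of $k$-ary words (including the empty word) that cyclically avoid $\tau$, and for a word $s_1\cdots s_l$ let $w(s_1\cdots s_l)=x_{s_1}\cdots x_{s_l}$. Then \[ \sum_{W\in A}w(W)=1+\sum_{i=1}^k\Phi\left(t^{-1}\cdot T\left\{u\frac{\partial^2}{\partial v\,\partial u}\bigg|_{v=1}H(x_i,u,v)\right\}\left(-1+\prod_{\substack{j=1\\ j\ne i}}^k T\{H(x_j,u,1)\}\right)\right)+\sum_{i=1}^k\frac{x_i-x_i^{mn}}{1-x_i}. \] In particular, setting $x_i=x$ for all $i$, \[ \sum_{W\in A}x^{\mathrm{len}(W)}=1+k\,\Phi\left(t^{-1}\cdot T\left\{u\frac{\partial^2}{\partial v\,\partial u}\bigg|_{v=1}H(x,u,v)\right\}\left(\big(T\{H(x,u,1)\}\big)^{k-1}-1\right)\right)+\frac{k(x-x^{mn})}{1-x}. \]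
   Context: A word $W=s_1\cdots s_l$ contains $\tau$ if it has $nm$ equal letters at positions $i_1<\cdots<i_{nm}$ such that within each successive block of $m$ of these positions the positions are consecutive; otherwise it avoids $\tau$. With $r(a_1\cdots a_l)=a_la_1\cdots a_{l-1}$, $W$ cyclically avoids $\tau$ if $r^j(W)$ avoids $\tau$ for every $j$. $\mathrm{len}(W)$ is the number of letters. A factorization on $\{1\}$ is an ordered list $(1^{c_1})\cdots(1^{c_p})$ of nonempty words, with $\mathrm{parts}=p$, $\mathrm{len}=c_1+\cdots+c_p$, $\mathrm{fst}=c_1$ ($\mathrm{fst}(\emptyset)=0$). It contains $\tau$ if the word obtained by inserting a letter $0$ between adjacent parts contains $\tau$ via an occurrence not using $0$ (equivalently, there are $n$ disjoint runs of $m$ consecutive ones each inside a single part). $H(x,u,v)=\sum_\phi x^{\mathrm{len}(\phi)}u^{\mathrm{parts}(\phi)}v^{\mathrm{fst}(\phi)}$, summed over all factorizations on $\{1\}$ (including the empty one) avoiding $\tau$. The polynomials $l_p(t)$ are defined by $\sum_{p\ge0}l_p(t)y^p=e^{ty/(1+y)}$ (so $l_p(t)=(-1)^pL_p^{(-1)}(t)$). $T$ is the linear map $u^p\mapsto l_p(t)$, applied coefficientwise to power series in $u$ with coefficients power series in the $x$-variables. $\Phi$ is the linear map $t^j\mapsto j!$ fixing other variables, applied coefficientwise; $t^{-1}$ times a series all of whose coefficients are polynomials in $t$ divisible by $t$ means dividing each coefficient by $t$. *)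

(* Defs.v *)
From mathcomp Require Import all_boot all_order all_algebra.
From mathcomp Require Import mpoly.

Set Implicit Arguments.
Unset Strict Implicit.
Unset Printing Implicit Defensive.

Import GRing.Theory.

Definition occurs_with (m n : nat) {T : eqType} (W : seq T) (c : T) : bool :=
  [exists s : (n * m).-tuple 'I_(size W),
    [&& sorted ltn (map val s),
        all (fun q => nth c W q == c) (map val s) &
        [forall b : 'I_n, forall j : 'I_m.-1,
            nth 0 (map val s) (b * m + j).+1
              == (nth 0 (map val s) (b * m + j)).+1]]].

Definition contains (m n : nat) {T : finType} (W : seq T) : bool :=
  [exists c : T, occurs_with m n W c].

Definition rcyc {T : Type} (W : seq T) : seq T := rotr 1 W.

Definition cyc_avoids (m n : nat) {T : finType} (W : seq T) : Prop :=
  forall j : nat, ~~ contains m n (iter j rcyc W).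

(* Factorizations on {1}: (1^{c_1})...(1^{c_p}) is encoded by the list *)
(* [:: c_1; ...; c_p] of positive integers.                           *)
Fixpoint fword (cs : seq nat) : seq nat :=
  if cs is c :: cs' then
    nseq c 1 ++ (if cs' is [::] then [::] else 0 :: fword cs')
  else [::].

Definition fact_contains (m n : nat) (cs : seq nat) : bool :=
  occurs_with m n (fword cs) 1.

Local Open Scope ring_scope.

(* Coefficient of x^L in H(x,u,v): a polynomial in u (outer variable)  *)
(* with coefficients polynomials in v (inner variable).  The sum runs  *)
(* over all factorizations phi with len(phi) = L (p = parts(phi) <= L, *)
(* each part <= L) avoiding tau; fst(phi) = head 0 phi.                *)
Definition Hcoef (m n L : nat) : {poly {poly rat}} :=
  \sum_(p < L.+1)
    \sum_(s : p.-tuple 'I_L.+1 |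
            [&& all (fun c => 0 < c)%N (map val s),
                sumn (map val s) == L &
                ~~ fact_contains m n (map val s)])
      ('X ^+ (head 0%N (map val s)))%:P * 'X ^+ p.

Definition Hcoef1 (m n L : nat) : {poly rat} :=
  map_poly (fun q : {poly rat} => q.[1]) (Hcoef m n L).

Definition Dcoef (m n L : nat) : {poly rat} :=
  'X * map_poly (fun q : {poly rat} => q.[1])
         (map_poly (fun q : {poly rat} => deriv q) (deriv (Hcoef m n L))).

(* l_p(t): coefficient of y^p in e^{t y/(1+y)}.  In {poly {poly rat}} *)
(* the outer variable is y and the inner one t; only the terms j <= p  *)
(* of the exponential series and the terms i <= p of the geometric     *)
(* series 1/(1+y) = sum_i (-y)^i can contribute to y^p.                *)
Definition lag (p : nat) : {poly rat} :=
  (\sum_(j < p.+1)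
      ((j`!)%:R^-1 *: ('X ^+ j : {poly rat}))%:P
      * ('X * \sum_(i < p.+1) (- 'X) ^+ i) ^+ j) `_ p.

Definition Tmap (q : {poly rat}) : {poly rat} :=
  \sum_(p < size q) q`_p *: lag p.

Definition Phi (q : {poly rat}) : rat :=
  \sum_(j < size q) q`_j * (j`!)%:R.

(* t^{-1} * q  (q is divisible by t) *)
Definition tinv (q : {poly rat}) : {poly rat} := q %/ 'X.

(* Everything truncated to x-degree <= N, which does not affect the  *)
(* coefficients of monomials of total degree <= N.                   *)
Definition THx (m n k N : nat) (j : 'I_k) : {mpoly {poly rat}[k]} :=
  \sum_(a < N.+1) Tmap (Hcoef1 m n a) *: 'X_j ^+ a.

Definition TDx (m n k N : nat) (i : 'I_k) : {mpoly {poly rat}[k]} :=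
  \sum_(a < N.+1) Tmap (Dcoef m n a) *: 'X_i ^+ a.

(* (x - x^{mn})/(1 - x) = x + x^2 + ... + x^{mn-1} *)
Definition rhs (m n k N : nat) : {mpoly rat[k]} :=
  1 + \sum_(i < k)
        map_mpoly (fun q => Phi (tinv q))
          (TDx m n N i * (-1 + \prod_(j < k | j != i) THx m n N j))
    + \sum_(i < k) \sum_(1 <= a < m * n) 'X_i ^+ a.

Definition THx1 (m n N : nat) : {poly {poly rat}} :=
  \sum_(a < N.+1) Tmap (Hcoef1 m n a) *: 'X ^+ a.

Definition TDx1 (m n N : nat) : {poly {poly rat}} :=
  \sum_(a < N.+1) Tmap (Dcoef m n a) *: 'X ^+ a.

Definition rhs1 (m n k N : nat) : {poly rat} :=
  1 + k%:R *: map_poly (fun q => Phi (tinv q))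
                 (TDx1 m n N * (THx1 m n N ^+ k.-1 - 1))
    + k%:R *: \sum_(1 <= a < m * n) 'X ^+ a.

(* Main.v *)
From HB Require Import structures.
Require Import Defs.
From mathcomp Require Import all_boot all_order all_algebra.
From mathcomp Require Import mpoly ring zify.

(** Contracting maximal runs turns a word into a Carlitz word (adjacent letters
    distinct) whose letters carry run lengths; a word with at least two distinct
    letters is, uniquely, a rotation inside the first run of such an expansion
    whose first and last letters differ.  Cyclic avoidance then only constrains,
    letter by letter, the factorization formed by the run lengths, so it remains
    to count Carlitz words with [p_j] letters [j].

    Let N be the number of all such words, N_i of those starting with [i], and C_i
    of those starting but not ending with [i].  They are the values of [Phi] at
    [\prod_j l_{p_j}], [l_{p_i}' \prod_{j<>i} l_{p_j}] and
    [(p_i l_{p_i} / t) \prod_{j<>i} l_{p_j}], because both sides satisfy the same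
    recurrences.  Deleting the first letter gives
    [N_i(p + e_i) + N_i(p) = N(p)], which is [l_{p+1}' + l_p' = l_p]; deleting a
    last letter [i] gives [C_i(p + e_i) + C_i(p) = N_i(p + e_i)], which is
    [g_{p+1} + g_p = l_{p+1}'] for [g_p = p l_p / t]; finally [N] is the sum of the
    [N_i], which is [Phi f' = Phi f - f(0)]. *)

Set Implicit Arguments.
Unset Strict Implicit.
Unset Printing Implicit Defensive.

Import GRing.Theory Num.Theory.
Local Open Scope ring_scope.

(** * The polynomials l_p and the maps Phi and T *)

(* The coefficient of y^p in (y / (1 + y))^j, i.e. (-1)^(p-j) 'C(p-1, j-1)
   for p, j > 0. *)
Fixpoint lag_coef (p j : nat) : rat :=
  match p, j with
  | 0, 0 => 1
  | 0, _.+1 | _.+1, 0 => 0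
  | p'.+1, j'.+1 => lag_coef p' j' - lag_coef p' j'.+1
  end.

Lemma lag_coefSS p j : lag_coef p.+1 j.+1 = lag_coef p j - lag_coef p j.+1.
Proof. by []. Qed.

Lemma lag_coef_small p j : (p < j)%N -> lag_coef p j = 0.
Proof. by elim: p j => [|p IH] [|j] //= lt_pj; rewrite !IH ?subrr ?(ltnW lt_pj). Qed.

(** With the closed form of [lag_coef] this is the ratio of the neighbouring binomials 'C(p-1, j-1)
    and 'C(p-1, j). *)
Lemma lag_coef_shift p j :
  (p%:R - j%:R) * lag_coef p j + j%:R * lag_coef p j.+1 = 0.
Proof.
elim: p j => [|p IH] [|j] /=; rewrite ?mul0r ?mulr0 ?addr0 ?subrr ?mul0r //.
(* The claim for p+1 and j+1 is the induction hypothesis at j minus the one at j+1. *)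
rewrite -[RHS](subrr 0) -{1}(IH j) -(IH j.+1) -!natr1; ring.
Qed.

(** The truncated series G satisfies (1 + y) G = y up to a term of degree M+1. Multiplying by G^j
    gives the recursion that defines [lag_coef], as long as only degrees below M are read. *)
Lemma coef_geom_pow (M p j : nat) : (p < M)%N ->
  (('X * \sum_(i < M) (- 'X) ^+ i) ^+ j : {poly {poly rat}})`_p
    = (lag_coef p j)%:P.
Proof.
set G := 'X * _.
have XG : (1 + 'X) * G = 'X - 'X * (- 'X) ^+ M.
  rewrite /G mulrCA (_ : _ * \sum_(i < M) _ = 1 - (- 'X) ^+ M); first by ring.
  by rewrite -[RHS]opprB subrX1 -mulNr opprD !opprK addrC.
elim: p j => [|p IH] [|j] ltpM //=; rewrite ?expr0 ?coef1 //.
  by rewrite exprS /G -mulrA coefXM.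
have /(congr1 (fun q : {poly _} => q`_p.+1)) : (1 + 'X) * G ^+ j.+1
    = 'X * (G ^+ j - (- 'X) ^+ M * G ^+ j).
  by rewrite exprS mulrA XG; ring.
rewrite mulrDl mul1r coefD !coefXM /= coefB !IH ?(ltnW ltpM) //.
rewrite exprNn -mulrA -mulrCA coefXnM (ltnW ltpM) subr0.
by rewrite polyCB => <-; rewrite addrK.
Qed.

Lemma coef_lag p j : (lag p)`_j = lag_coef p j / (j`!)%:R.
Proof.
rewrite /lag coef_sum.
under eq_bigr => i _ do rewrite coefCM coef_geom_pow //.
rewrite coef_sum; under eq_bigr => i _ do rewrite coefMC coefZ coefXn.
have [ltjp|lepj] := ltnP j p.+1; last first.
  rewrite lag_coef_small // mul0r big1 // => i _.
  by rewrite eqn_leq [(j <= i)%N]leqNgt (leq_trans (ltn_ord i) lepj) mulr0 mul0r.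
rewrite (bigD1 (Ordinal ltjp)) //= eqxx mulr1 mulrC big1 ?addr0 // => i.
by rewrite -val_eqE /= eq_sym => /negPf->; rewrite mulr0 mul0r.
Qed.

Lemma lag0 : lag 0 = 1.
Proof. by apply/polyP => -[|j]; rewrite coef_lag coef1 /= ?divr1 ?mul0r. Qed.

Lemma lagS_coef0 p : (lag p.+1)`_0 = 0.
Proof. by rewrite coef_lag mul0r. Qed.

Lemma fact_neq0 j : (j`!)%:R != 0 :> rat.
Proof. by rewrite pnatr_eq0 -lt0n fact_gt0. Qed.

Lemma coef_deriv_lag p j : ((lag p)^`())`_j = lag_coef p j.+1 / (j`!)%:R.
Proof.
rewrite coef_deriv coef_lag factS natrM -mulr_natr; field.
by rewrite fact_neq0 nat1r pnatr_eq0.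
Qed.

(** Differentiating e^{ty/(1+y)} in t multiplies it by y/(1+y); clearing 1+y gives this recurrence.
    On coefficients it is the recursion of [lag_coef]. *)
Lemma deriv_lagS p : (lag p.+1)^`() = lag p - (lag p)^`().
Proof.
by apply/polyP => j; rewrite coefB !coef_deriv_lag coef_lag /= mulrBl.
Qed.

(** This is what u d/du, then T, then division by t make of u^p. *)
Definition clag p := tinv (lag p *+ p).

Lemma coef_tinv q j : (tinv q)`_j = q`_j.+1.
Proof.
by rewrite /tinv -['X]expr1 -Pdiv.IdomainMonic.drop_poly_divp coef_drop_poly addn1.
Qed.

(** The division by t is exact: for p = 0 the factor p vanishes, and for p > 0 the constant term of
    l_p does. *)
Lemma mulX_clag p : 'X * clag p = lag p *+ p.
Proof.
apply/polyP => -[|j]; rewrite coefXM /=; last by rewrite coef_tinv.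
by case: p => [|p]; rewrite ?coef0 ?mulr0n // coefMn lagS_coef0 mul0rn.
Qed.

Lemma clag0 : clag 0 = 0.
Proof. by rewrite /clag mulr0n /tinv div0p. Qed.

(** At t^j the two sides differ by the left side of [lag_coef_shift] divided by (j+1)!. *)
Lemma clagS p : clag p.+1 = (lag p.+1)^`() - clag p.
Proof.
apply/polyP => j; rewrite coefB coef_deriv_lag !coef_tinv !coefMn !coef_lag.
have := lag_coef_shift p j; 
rewrite -(mulr_natr (_ / _) p.+1) -(mulr_natr (_ / _) p).
rewrite lag_coefSS.
move: (lag_coef p j) (lag_coef p j.+1) => a b ab.
have Dj : j.+1%:R != 0 :> rat by rewrite pnatr_eq0.
rewrite factS natrM -!natr1; apply/eqP; rewrite -subr_eq0.
move: (j`!)%:R (fact_neq0 j) => f f0; rewrite -natr1 in Dj.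
set X := (X in X == 0).
have -> : X = ((p%:R - j%:R) * a + j%:R * b) / f / (j%:R + 1).
  by rewrite /X; field; rewrite f0 ?Dj ?[1 + _]addrC ?Dj.
by rewrite ab !mul0r.
Qed.

(** The range of summation in [Phi] depends on its argument; a common bound is needed to compare
    different polynomials. *)
Lemma Phi_widen M (q : {poly rat}) : (size q <= M)%N ->
  Phi q = \sum_(j < M) q`_j * (j`!)%:R.
Proof.
move=> le_qM; rewrite /Phi (big_ord_widen M (fun j => q`_j * (j`!)%:R)) //.
rewrite big_mkcond; apply: eq_bigr => i _; case: ltnP => // le_qi.
by rewrite nth_default ?mul0r.
Qed.

Lemma Phi_is_additive : zmod_morphism Phi.
Proof.
move=> p q; pose M := maxn (size (p - q)) (maxn (size p) (size q)).
rewrite !(@Phi_widen M) ?leq_max ?leqnn ?orbT // -sumrB.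
by apply: eq_bigr => j _; rewrite coefB mulrBl.
Qed.

HB.instance Definition _ :=
  GRing.isZmodMorphism.Build {poly rat} rat Phi Phi_is_additive.

(* Phi f is the integral of f(t) e^{-t} over t >= 0: this is integration by parts. *)
Lemma Phi_deriv f : Phi f^`() = Phi f - f`_0.
Proof.
rewrite (@Phi_widen (size f) f^`()); last first.
  have [->|f0] := eqVneq f 0; first by rewrite deriv0.
  exact: ltnW (lt_size_deriv f0).
rewrite (@Phi_widen (size f).+1 f) // big_ord_recl mulr1 addrC addKr.
by apply: eq_bigr => j _; rewrite coef_deriv lift0 factS natrM mulrA
  -[_ *+ j.+1 in LHS]mulr_natr.
Qed.

Lemma Phi1 : Phi 1 = 1.
Proof. by rewrite (@Phi_widen 1) ?size_poly1 // big_ord1 coef1 mulr1. Qed.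

Lemma tinv_is_additive : zmod_morphism tinv.
Proof. by move=> p q; apply/polyP => j; rewrite coefB !coef_tinv coefB. Qed.

HB.instance Definition _ :=
  GRing.isZmodMorphism.Build {poly rat} {poly rat} tinv tinv_is_additive.

Lemma tinv_mulX q : tinv ('X * q) = q.
Proof. by apply/polyP => j; rewrite coef_tinv coefXM. Qed.

Lemma Tmap_widen M (q : {poly rat}) : (size q <= M)%N ->
  Tmap q = \sum_(p < M) q`_p *: lag p.
Proof.
move=> le_qM; rewrite /Tmap (big_ord_widen M (fun p => q`_p *: lag p)) //.
rewrite big_mkcond; apply: eq_bigr => i _; case: ltnP => // le_qi.
by rewrite nth_default ?scale0r.
Qed.

Lemma Tmap_is_additive : zmod_morphism Tmap.
Proof.
move=> p q; pose M := maxn (size (p - q)) (maxn (size p) (size q)).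
rewrite !(@Tmap_widen M) ?leq_max ?leqnn ?orbT // -sumrB.
by apply: eq_bigr => j _; rewrite coefB scalerBl.
Qed.

HB.instance Definition _ :=
  GRing.isZmodMorphism.Build {poly rat} {poly rat} Tmap Tmap_is_additive.

Lemma TmapXn p : Tmap 'X^p = lag p.
Proof.
rewrite (@Tmap_widen p.+1) ?size_polyXn // big_ord_recr /= coefXn eqxx scale1r.
rewrite big1 ?add0r // => i _; rewrite coefXn ltn_eqF ?scale0r //.
Qed.

Lemma deriv_prod (R : comNzRingType) (I : finType) (F : I -> {poly R}) :
  (\prod_i F i)^`() = \sum_i (F i)^`() * \prod_(j | j != i) F j.
Proof.
have H (r : seq I) : uniq r -> (\prod_(i <- r) F i)^`()
    = \sum_(i <- r) (F i)^`() * \prod_(j <- r | j != i) F j.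
  elim: r => [|a r IH] /= => [_|/andP[nar ur]].
    by rewrite !big_nil -[1]/(1%:P) derivC.
  rewrite !big_cons derivM IH // eqxx mulr_sumr; congr (_ * _ + _).
    rewrite [RHS]big_seq_cond [LHS]big_seq; apply: eq_bigl => i.
    by case: (boolP (i \in r)) => //= ir; case: eqP ir nar => // -> ->.
  rewrite [LHS]big_seq [RHS]big_seq; apply: eq_bigr => i ir.
  rewrite big_cons ifT; first by rewrite mulrCA.
  by apply: contraNneq nar => ->.
exact: H (index_enum_uniq I).
Qed.

(** * Counting Carlitz words *)

(** Cyclic avoidance is a proposition over an infinite type of words, so a finite cardinality is
    expressed by a duplicate-free enumeration. The count is rational because it is compared with
    values of [Phi]. *)
Definition counts (T : eqType) (P : T -> Prop) (q : rat) : Prop :=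
  exists Ws : seq T,
    [/\ uniq Ws, (forall W, W \in Ws <-> P W) & (size Ws)%:R = q].

Section Counts.
Variables T U : eqType.
Implicit Types (P Q : T -> Prop) (q : rat).

Lemma counts_ext P Q q :
  (forall x, P x <-> Q x) -> counts P q -> counts Q q.
Proof.
move=> PQ [Ws [uW WP sz]]; exists Ws; split=> // W.
by split=> [/WP/PQ|/PQ/WP].
Qed.

Lemma counts0 P : (forall x, ~ P x) -> counts P 0.
Proof. by move=> nP; exists [::]; split=> // x; split=> // /nP. Qed.

Lemma counts1 P a : (forall x, P x <-> x = a) -> counts P 1.
Proof.
move=> Pa; exists [:: a]; split=> // x; rewrite inE.
by split=> [/eqP/Pa|/Pa->].
Qed.

Lemma counts_bij (P : T -> Prop) (Q : U -> Prop) (f : T -> U) (g : U -> T) q :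
  (forall x, P x -> Q (f x) /\ g (f x) = x) ->
  (forall y, Q y -> P (g y) /\ f (g y) = y) ->
  counts P q -> counts Q q.
Proof.
move=> PQ QP [Ws [uW WP sz]]; exists (map f Ws); rewrite size_map; split=> //.
  rewrite map_inj_in_uniq // => x y /WP/PQ[_ {2}<-] /WP/PQ[_ {2}<-].
  by move->.
move=> y; split=> [/mapP[x /WP/PQ[Qx _] ->] // | /QP[Pg <-]].
by apply/map_f/WP.
Qed.

Lemma counts_bigU (I : eqType) (r : seq I) (P : I -> T -> Prop) (q : I -> rat) :
  uniq r -> (forall i, i \in r -> counts (P i) (q i)) ->
  (forall i j x, P i x -> P j x -> i = j) ->
  counts (fun x => exists2 i, i \in r & P i x) (\sum_(i <- r) q i).
Proof.
move=> + + disj; elim: r => [_ _|a r IH /= /andP[nar ur] cP].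
  by rewrite big_nil; apply: counts0 => x [].
have [|Ws [uW WP sz]] := IH ur; first by move=> i ir; apply: cP; rewrite inE ir orbT.
have [Vs [uV VP szV]] := cP a (mem_head _ _).
exists (Vs ++ Ws); rewrite big_cons size_cat natrD sz szV; split=> //.
  rewrite cat_uniq uV uW andbT -all_predC; apply/allP => x /WP[i ir Pi] /=.
  by apply: contra nar => /VP Pa; rewrite (disj _ _ _ Pa Pi).
move=> x; rewrite mem_cat; split=> [/orP[/VP Pa|/WP[i ir Pi]]|[i]].
- by exists a; rewrite ?mem_head.
- by exists i; rewrite // inE ir orbT.
rewrite inE => /orP[/eqP-> /VP->//|ir Pi].
by apply/orP; right; apply/WP; exists i.
Qed.

Lemma counts_add P Q q q' : counts P q -> counts Q q' ->
  (forall x, P x -> ~ Q x) -> counts (fun x => P x \/ Q x) (q + q').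
Proof.
move=> cP cQ PQ.
have := @counts_bigU _ [:: true; false] (fun b x => if b then P x else Q x)
  (fun b : bool => if b then q else q') isT.
rewrite !big_cons big_nil addr0 => cU; apply: counts_ext (cU _ _).
- move=> x; split=> [[[] _]|[]]; [by left | by right | by exists true |].
  by exists false.
- by case.
by case=> -[] x // Hx /(PQ x) nHx; rewrite ?(nHx Hx) //; case: (PQ x).
Qed.

Lemma counts_diff P (b : pred T) q q' :
  counts P q -> counts (fun x => P x /\ b x) q' ->
  counts (fun x => P x /\ ~~ b x) (q - q').
Proof.
move=> [Ws [uW WP <-]] [Vs [uV VP <-]].
exists (filter (predC b) Ws); split; first exact: filter_uniq.
  by move=> x; rewrite mem_filter /=; split=> [/andP[? /WP]|[/WP-> ->]].
have /perm_size-> : perm_eq Vs (filter b Ws).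
  apply: uniq_perm => //; first exact: filter_uniq.
  move=> x; rewrite mem_filter; apply/idP/idP => [/VP[/WP-> ->]//|].
  by move=> /andP[? /WP ?]; apply/VP.
by rewrite !size_filter -(count_predC b Ws) natrD [X in X - _]addrC addrK.
Qed.

(** The second component will be the offset of a rotation inside the first run of a word. *)
Lemma counts_pairs P q (c : nat) :
  counts P q -> counts (fun x : T * nat => P x.1 /\ (x.2 < c)%N) (q *+ c).
Proof.
move=> [Ws [uW WP <-]]; exists [seq (x, o) | x <- Ws, o <- iota 0 c]; split.
- by apply: allpairs_uniq; rewrite ?iota_uniq // => -[? ?] [? ?] _ _ [-> ->].
- move=> [x o] /=; split=> [/allpairsP[[y p] /= [/WP ? + [-> ->]]]|[/WP xW oc]].
    by rewrite mem_iota.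
  by apply/allpairsP; exists (x, o); rewrite mem_iota.
by rewrite size_allpairs size_iota natrM mulr_natr.
Qed.

End Counts.

(** * Recurrences for Carlitz words with prescribed labels *)

Section LabelledCarlitz.
Variable I : finType.
Implicit Types (w : seq (I * nat)) (s : I -> seq nat) (i j : I).

Definition proj j w := [seq x.2 | x <- w & x.1 == j].
Definition carlitz w := sorted (fun x y => x.1 != y.1) w.
(** The option type makes the empty word start with no letter at all, and likewise for [ends]. *)
Definition starts i w := head None [seq Some x.1 | x <- w] == Some i.
Definition ends i w := last None [seq Some x.1 | x <- w] == Some i.
(** The labels are forced by the order of occurrence, so these words correspond to the Carlitz words
    with [size (s j)] letters j. *)
Definition carlitz_for s w := carlitz w /\ forall j, proj j w = s j.
Definition upd s i t j := if j == i then t else s j.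

Lemma carlitz_cons x w : carlitz (x :: w) = ~~ starts x.1 w && carlitz w.
Proof. by case: w => [|y w] //=; rewrite /starts /= /eq_op /= eq_sym. Qed.

Lemma carlitz_rcons x w : carlitz (rcons w x) = carlitz w && ~~ ends x.1 w.
Proof.
case: w => [|y w] //; rewrite /carlitz /= rcons_path; congr (_ && _).
by rewrite /ends /= last_map.
Qed.

Lemma proj_cons j x w :
  proj j (x :: w) = if x.1 == j then x.2 :: proj j w else proj j w.
Proof. by rewrite /proj /=; case: ifP. Qed.

Lemma proj_rcons j x w :
  proj j (rcons w x) = if x.1 == j then rcons (proj j w) x.2 else proj j w.
Proof. by rewrite /proj filter_rcons; case: ifP => //; rewrite map_rcons. Qed.

Lemma carlitz_for_nil s w :
  (forall j, s j = [::]) -> carlitz_for s w <-> w = [::].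
Proof.
move=> s0; split=> [[_]|->]; last by split.
by case: w => // x w /(_ x.1); rewrite proj_cons eqxx s0.
Qed.

(** Deleting the first letter i leaves exactly the words for the shortened data that do not start
    with i. *)
Lemma counts_start_step s i a t X Y : s i = a :: t ->
  counts (carlitz_for (upd s i t)) X ->
  counts (fun w => carlitz_for (upd s i t) w /\ starts i w) Y ->
  counts (fun w => carlitz_for s w /\ starts i w) (X - Y).
Proof.
move=> si cX cY; apply: (@counts_bij _ _ _ _ (cons (i, a)) behead _ _ _
  (counts_diff cX cY)) => [w [[cw pw] nst]|[[]//|x w [[cw pw] xi]]].
  split=> //; split; last by rewrite /starts /= eqxx.
  split=> [|j]; first by rewrite carlitz_cons nst.
  rewrite proj_cons pw /upd /= eq_sym.
  by case: eqVneq => // ->; rewrite si.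
move: xi cw; rewrite {1}/starts carlitz_cons => /eqP[xi]; rewrite xi => /andP[nst cw].
have := pw i; rewrite proj_cons xi eqxx si => -[xa pi].
split; last by rewrite -xi -xa; case: (x).
split=> //; split=> // j; rewrite /upd; case: eqVneq => [->//|ji].
by rewrite -(pw j) proj_cons xi eq_sym (negPf ji).
Qed.

(** The words that both start and end with i are removed; deleting their last letter gives the words
    for the shortened data that start but do not end with i. *)
Lemma counts_end_step s i j a t X Y : s i = rcons t a -> j != i -> s j <> [::] ->
  counts (fun w => carlitz_for s w /\ starts i w) X ->
  counts (fun w => (carlitz_for (upd s i t) w /\ starts i w) /\ ~~ ends i w) Y ->
  counts (fun w => (carlitz_for s w /\ starts i w) /\ ~~ ends i w) (X - Y).
Proof.
move=> si ji sj cX cY; apply: counts_diff (cX) _; move: cY.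
apply: (@counts_bij _ _ _ _ (rcons^~ (i, a)) (fun w => rev (behead (rev w)))) => w.
  move=> [[[cw pw] sw] nen]; split; last by rewrite rev_rcons revK.
  split; last by rewrite /ends map_rcons last_rcons.
  split; last by move: sw; case: (w).
  split=> [|j']; first by rewrite carlitz_rcons cw.
  rewrite proj_rcons pw /upd /= eq_sym.
  by case: eqVneq => // ->; rewrite si.
case/lastP: w => [[[]]//|w x] [[[cw pw] sw]].
rewrite /ends map_rcons last_rcons => /eqP[xi].
rewrite rev_rcons /= revK.
have := pw i; rewrite proj_rcons xi eqxx si => /rcons_inj[pi xa].
move: cw; rewrite carlitz_rcons xi => /andP[cw nen].
split; last by rewrite -xi -xa; case: (x).
(* The shortened word still starts with i because it is nonempty: it contains a letter j different
   from i. *)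
split=> //; split; last first.
  case: w sw pw {cw pi nen} => // _ /(_ j).
  by rewrite /proj /= xi eq_sym (negPf ji) => /esym/sj.
split=> // j'; rewrite /upd; case: eqVneq => [->//|j'i].
by rewrite -(pw j') proj_rcons xi eq_sym (negPf j'i).
Qed.

Lemma prod_lag_upd s i t :
  \prod_(j | j != i) lag (size (upd s i t j)) = \prod_(j | j != i) lag (size (s j)).
Proof. by apply: eq_bigr => j /negPf ji; rewrite /upd ji. Qed.

(** Both claims go by one induction on the length: the words with a given first letter reduce to
    shorter words, and the full count is then the sum over the first letter. *)
Lemma counts_carlitz_rec n s : (\sum_j size (s j) = n)%N ->
  counts (carlitz_for s) (Phi (\prod_j lag (size (s j)))) /\
  forall i, counts (fun w => carlitz_for s w /\ starts i w)
    (Phi ((lag (size (s i)))^`() * \prod_(j | j != i) lag (size (s j)))).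
Proof.
elim: n s => [|n IH] s sz.
  have s0 j : s j = [::].
    apply/eqP; rewrite -size_eq0; move/eqP: sz; rewrite sum_nat_eq0.
    by move/forallP/(_ j).
  split=> [|i].
    rewrite big1 => [|j _]; last by rewrite s0 lag0.
    by rewrite Phi1; apply: counts1 => w; apply: carlitz_for_nil.
  rewrite s0 lag0 -[1]/(1%:P) derivC mul0r raddf0; apply: counts0 => w.
  by move=> [/(carlitz_for_nil _ s0)->].
have cS i : counts (fun w => carlitz_for s w /\ starts i w)
    (Phi ((lag (size (s i)))^`() * \prod_(j | j != i) lag (size (s j)))).
  case E: (s i) => [|a t].
    rewrite lag0 -[1]/(1%:P) derivC mul0r raddf0; apply: counts0 => -[[_ //]|x w].
    move=> [[_ /(_ i)]]; rewrite proj_cons E /starts /= => /[swap] /eqP[->].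
    by rewrite eqxx.
  have [|cX cY] := IH (upd s i t).
    move: sz; rewrite (bigD1 i) // E [X in _ -> X = _](bigD1 i) //= {1}/upd eqxx.
    move=> [<-]; congr addn; apply: eq_bigr => j /negPf ji; by rewrite /upd ji.
  have := counts_start_step E cX (cY i).
  rewrite (bigD1 i) //= prod_lag_upd {1 2}/upd eqxx deriv_lagS mulrBl.
  by rewrite raddfB.
(* By the product rule the sum over i is [Phi] of the derivative of the product. This equals [Phi]
   of the product itself, whose constant term vanishes because some letter occurs. *)
split=> //; have := counts_bigU (index_enum_uniq I) (fun i _ => cS i).
rewrite -raddf_sum /= -deriv_prod Phi_deriv.
have -> : (\prod_j lag (size (s j)))`_0 = 0.
  have [j] : exists j, s j != [::].
    apply/existsP; rewrite -[X in is_true X]negbK negb_exists.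
    apply/negP => /forallP s0; move: sz; rewrite big1 // => j _.
    by have := s0 j; rewrite negbK => /eqP->.
  case E: (s j) => [//|a t] _.
  by rewrite (bigD1 j) //= E coefM big_ord1 lagS_coef0 mul0r.
rewrite subr0 => cU; apply: counts_ext (cU _) => [w|i j w [_ /eqP si] [_ /eqP]].
  split=> [[i _ []]//|cw].
  case: w cw => [[_ s0]|x w cw].
    by move: sz; rewrite big1 // => j _; rewrite -s0.
  by exists x.1; rewrite ?mem_index_enum // /starts eqxx.
by rewrite si => -[].
Qed.

(** Induction from the right end of [s i]: the step is the recurrence of [clag], and with no letter
    i left there is no word, in agreement with g_0 = 0. *)
Lemma counts_cyclic_carlitz s i j : j != i -> s j <> [::] ->
  counts (fun w => (carlitz_for s w /\ starts i w) /\ ~~ ends i w)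
    (Phi (clag (size (s i)) * \prod_(j | j != i) lag (size (s j)))).
Proof.
move=> ji; move E: (s i) => t; elim/last_ind: t s E => [|t a IH] s E sj.
  rewrite clag0 mul0r raddf0; apply: counts0 => -[[[_ //]]|x w].
  move=> [[[_ /(_ i)]]]; rewrite proj_cons E /starts /= => /[swap] /eqP[->].
  by rewrite eqxx.
have [_ /(_ i) cX] := counts_carlitz_rec (erefl (\sum_j size (s j))%N).
have := counts_end_step E ji sj cX (IH (upd s i t) _ _).
rewrite E prod_lag_upd size_rcons clagS mulrBl raddfB /=; apply.
  by rewrite /upd eqxx.
by rewrite /upd (negPf ji).
Qed.

End LabelledCarlitz.

(** * Occurrences and run lengths *)

Section Blocks.
Local Open Scope nat_scope.
Variables (T : eqType) (m : nat) (c : T).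
Hypothesis m_gt0 : 0 < m.
Implicit Types (W A B : seq T) (r n q : nat) (p : seq nat).

(* Greedy left-to-right count of disjoint blocks c^m; r < m is the length of the
   block under construction. *)
Fixpoint blocks r W : nat :=
  if W is a :: W' then
    if a == c then if r.+1 == m then (blocks 0 W').+1 else blocks r.+1 W'
    else blocks 0 W'
  else 0.

Fixpoint pending r W : nat :=
  if W is a :: W' then
    if a == c then if r.+1 == m then pending 0 W' else pending r.+1 W'
    else pending 0 W'
  else r.

Lemma blocks_cat r A B : blocks r (A ++ B) = blocks r A + blocks (pending r A) B.
Proof.
by elim: A r => //= a A IH r; case: ifP => _ //; case: ifP => _ //; rewrite IH.
Qed.

Lemma pending_lt r W : r < m -> pending r W < m.
Proof.
elim: W r => //= a W IH r rm; case: ifP => _; last exact: IH.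
by case: ifP => [_|/negbT rm1]; apply: IH => //; rewrite ltn_neqAle rm1.
Qed.

Lemma pending_break r A a : a != c -> pending r (rcons A a) = 0.
Proof.
by move=> /negPf ac; elim: A r => [|b A IH] r /=; rewrite ?ac ?IH ?if_same.
Qed.

Lemma blocks_break r B : ohead B != Some c -> blocks r B = blocks 0 B.
Proof. by case: B => [//|b B] bc /=; rewrite !ifN. Qed.

(** When the longer partial block is completed, that scan restarts at 0 with a lead of one. The
    other scan is then the one further along, and it can make up at most that one block. *)
Lemma blocks_mono r r' W : r <= r' < m ->
  blocks r W <= blocks r' W <= (blocks r W).+1.
Proof.
elim: W r r' => //= a W IH r r' /andP[le_rr' lt_r'm].
case: (a == c); last by rewrite leqnn leqnSn.
case: eqP => [rm|/eqP rm].
  have -> : r' = r by lia.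
  by rewrite rm eqxx leqnn leqnSn.
case: eqP => [r'm|/eqP r'm]; last by apply: IH; lia.
by have := IH 0 r.+1; rewrite ltnS; lia.
Qed.

Lemma blocks_cat_ge A B : blocks 0 A + blocks 0 B <= blocks 0 (A ++ B).
Proof.
rewrite blocks_cat leq_add2l.
by have /andP[] := @blocks_mono 0 (pending 0 A) B (pending_lt A m_gt0).
Qed.

Lemma blocks_drop q W : blocks 0 (drop q W) <= blocks 0 W.
Proof.
rewrite -{2}(cat_take_drop q W); apply: leq_trans (blocks_cat_ge _ _).
exact: leq_addl.
Qed.

Lemma blocks_nseq r a : r < m -> blocks r (nseq a c) = (r + a) %/ m.
Proof.
elim: a r => [|a IH] r lt_rm /=; first by rewrite addn0 divn_small.
rewrite eqxx; case: eqP => [rm|/eqP rm]; last by rewrite IH ?addSnnS; lia.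
by rewrite IH // add0n -addSnnS rm divnDl // divnn m_gt0.
Qed.

Lemma blocks_nseq_neq r a b : b != c -> blocks r (nseq a b) = 0.
Proof. by move=> /negPf bc; elim: a r => //= a IH r; rewrite bc IH. Qed.

Lemma pending_nseq_neq a b : b != c -> pending 0 (nseq a b) = 0.
Proof. by move=> /negPf bc; elim: a => //= a IH; rewrite bc IH. Qed.

(** At the junction of [B ++ A] the last and the first letter of [A ++ B] meet. They differ, so no
    block crosses the junction and the count is the sum over the two pieces, which [A ++ B] attains
    as well. *)
Lemma blocks_swap A B : ohead (A ++ B) != ohead (rev (A ++ B)) ->
  blocks 0 (B ++ A) <= blocks 0 (A ++ B).
Proof.
case: A => [|a A]; first by rewrite cats0.
case/lastP: B => [|B b]; first by rewrite cats0.
rewrite -rcons_cat rev_rcons rcons_cat => ab.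
apply: leq_trans (blocks_cat_ge _ _).
rewrite blocks_cat addnC leq_add2r; have [eq_bc|bc] := eqVneq b c.
  by rewrite blocks_break // -eq_bc.
by rewrite pending_break.
Qed.

(** An occurrence is determined by where its blocks start; the comparison with [nseq m c] also
    forces every block to fit inside [W]. *)
Definition starting_at W p :=
  sorted (fun a b => a + m <= b) p
  && all (fun q => take m (drop q W) == nseq m c) p.

Lemma starting_at_shift A W p :
  starting_at W p -> starting_at (A ++ W) (map (addn (size A)) p).
Proof.
case/andP=> sp /allP ap; apply/andP; split.
  by rewrite sorted_map; apply: sub_sorted sp => x y /=; rewrite -addnA leq_add2l.
apply/allP => _ /mapP[q /ap qW ->].
by rewrite addnC -drop_drop drop_size_cat.
Qed.

(** The greedy count is optimal. The claim is strengthened to suffixes of [W], so that the first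
    block can be cut off in the induction. *)
Lemma starting_at_blocks W p : starting_at W p -> size p <= blocks 0 W.
Proof.
suff: forall x, all (leq x) p -> starting_at W p -> size p <= blocks 0 (drop x W).
  by move=> /(_ 0); rewrite drop0; apply; apply/allP.
elim: p => //= q p IH x /andP[xq _] /andP[/= pq /andP[/eqP qW ap]].
apply: leq_trans (_ : blocks 0 (drop q W) <= _); last first.
  by rewrite -{1}(subnK xq) -drop_drop blocks_drop.
rewrite -(cat_take_drop m (drop q W)) qW drop_drop.
apply: leq_trans (blocks_cat_ge _ _).
rewrite blocks_nseq // add0n divnn m_gt0 add1n ltnS [m + q]addnC; apply: IH.
  by apply: order_path_min pq => ? ? ?; lia.
by rewrite /starting_at ap (path_sorted pq).
Qed.

Lemma blocks_starting_at n W : n <= blocks 0 W ->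
  exists2 p, size p = n & starting_at W p.
Proof.
(* A scan in state r behaves as if r letters c had already been read in front of [W]. *)
suff: forall r, r < m -> n <= blocks r W ->
    exists2 p, size p = n & starting_at (nseq r c ++ W) p.
  by move=> /(_ 0 m_gt0).
elim: W n => [|a W IH] n r lt_rm /=.
  by rewrite leqn0 => /eqP->; exists [::].
case: eqVneq => [->|ac] => [|/(IH _ _ m_gt0)[p sp pW]]; last first.
  exists (map (addn r.+1) p); first by rewrite size_map.
  have := starting_at_shift (rcons (nseq r c) a) pW.
  by rewrite size_rcons size_nseq cat_rcons.
rewrite -cat_rcons -[rcons _ _]/(rcons (nseq r c) c).
have -> : rcons (nseq r c) c = nseq r.+1 c.
  by elim: (r) => //= x ->.
case: eqP => [rm|/eqP rm]; last by apply: IH; lia.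
rewrite rm; case: n => [|n]; first by exists [::].
rewrite ltnS => /(IH _ _ m_gt0)[p sp pW].
exists (0 :: map (addn m) p); first by rewrite /= size_map sp.
have := starting_at_shift (nseq m c) pW; rewrite size_nseq /starting_at /=.
case/andP=> s_p ->; rewrite path_min_sorted ?s_p /=; last first.
  by apply/allP => _ /mapP[q _ ->]; rewrite add0n leq_addr.
by rewrite drop0 take_size_cat ?size_nseq // eqxx.
Qed.

Lemma nth_flatten_iota p b j : b < size p -> j < m ->
  nth 0 (flatten [seq iota q m | q <- p]) (b * m + j) = nth 0 p b + j.
Proof.
elim: p b => //= q p IH [|b] bp jm; first by rewrite nth_cat size_iota jm nth_iota.
by rewrite nth_cat size_iota mulSn -addnA ltnNge leq_addr addKn IH.
Qed.

Lemma occurs_withP n W : 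
  reflect (exists2 p, size p = n & starting_at W p) (occurs_with m n W c).
Proof.
apply: (iffP existsP) => [[s /and3P[ss sc /forallP sb]]|[p sp /andP[ps pW]]].
  have size_s : size (map val s) = n * m by rewrite size_map size_tuple.
  have s_lt x : x < n * m -> nth 0 (map val s) x < size W.
    move=> xs; have /mapP[y _ ->] : nth 0 (map val s) x \in map val s.
      by rewrite mem_nth ?size_s.
    exact: ltn_ord.
  move: (map val s) size_s s_lt ss sc sb => l size_l l_lt sl lc lb {s}.
  have nth_s b j : b < n -> j < m ->
      nth 0 l (b * m + j) = nth 0 l (b * m) + j.
    move=> bn; elim: j => [|j IH] jm; first by rewrite !addn0.
    have jm' : j < m.-1 by lia.
    have /forallP/(_ (Ordinal jm')) := lb (Ordinal bn).
    by rewrite /= addnS => /eqP->; rewrite IH ?addnS // ltnW.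
  have bm_lt b j : b < n -> j < m -> b * m + j < n * m.
    move=> bn jm; apply: (@leq_trans (b.+1 * m)).
      by rewrite mulSn addnC ltn_add2r.
    by rewrite leq_mul2r bn orbT.
  (* Every m-th position of the occurrence starts a block. *)
  exists (mkseq (fun b => nth 0 l (b * m)) n); first exact: size_mkseq.
  apply/andP; split.
    apply/(sortedP 0) => b; rewrite size_mkseq => bn.
    rewrite !nth_mkseq ?(ltnW bn) //.
    have bS : (b * m + m.-1).+1 = b.+1 * m + 0 by rewrite mulSn; lia.
    have /(sortedP 0)/(_ (b * m + m.-1)) := sl; rewrite bS size_l bm_lt //.
    move=> /(_ isT); rewrite addn0 nth_s ?(ltnW bn) ?ltn_predL //; lia.
  apply/allP => q /mapP[b]; rewrite mem_iota /= add0n => bn ->.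
  set q0 := nth 0 _ _.
  have q0W j : j < m -> q0 + j < size W.
    by move=> jm; rewrite -nth_s // l_lt // bm_lt.
  have sz : size (take m (drop q0 W)) = m.
    have := q0W m.-1; rewrite ltn_predL m_gt0 => /(_ isT).
    by move=> q0m; rewrite size_takel // size_drop; lia.
  apply/eqP/(@eq_from_nth _ c); rewrite sz ?size_nseq // => j jm.
  rewrite nth_take // nth_drop nth_nseq jm -nth_s //; apply/eqP.
  by move/allP: lc; apply; apply: mem_nth; rewrite size_l bm_lt.
(* Conversely, every start is expanded into the m consecutive positions of its block. *)
pose l := flatten [seq iota q m | q <- p].
have size_l : size l = n * m.
  rewrite /l -sp; elim: (p) => //= q p' IH.
  by rewrite size_cat size_iota IH mulSn.
have pbm x : x < n * m -> x = (x %/ m) * m + x %% m /\ x %/ m < size p.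
  by move=> xnm; rewrite -divn_eq sp ltn_divLR.
have l_lt : all (gtn (size W)) l && all (fun q => nth c W q == c) l.
  rewrite -all_predI; apply/allP => x /flatten_mapP[q qp].
  rewrite mem_iota => /andP[qx xqm].
  have /eqP := allP pW _ qp; move=> /[dup] /(congr1 size).
  rewrite size_nseq size_take size_drop => sz /(congr1 (fun s => nth c s (x - q))).
  have xqm' : x - q < m by lia.
  rewrite nth_take // nth_drop nth_nseq xqm' subnKC //= => ->.
  rewrite eqxx andbT; move: sz; case: (ltnP m (size W - q)) => /=; lia.
have [s sl] : exists s : seq 'I_(size W), map val s = l.
  case/andP: l_lt => + _; elim: (l) => [_|x l' IH /= /andP[xW /IH[s <-]]].
    by exists [::].
  by exists (Ordinal xW :: s).
have size_s : size s == n * m by rewrite -(size_map val) sl size_l.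
exists (Tuple size_s); apply/and3P; rewrite /= sl; split.
- apply/(sortedP 0) => x; rewrite size_l => xnm.
  have [xE xp] := pbm x (ltnW xnm); have xm := ltn_pmod x m_gt0.
  have [jm|jm] := ltnP (x %% m).+1 m.
    by rewrite xE -addnS !nth_flatten_iota // addnS /= ltnSn.
  have xS : x.+1 = (x %/ m).+1 * m + 0 by rewrite {1}xE mulSn; lia.
  have xSp : (x %/ m).+1 < size p by rewrite sp -(ltn_pmul2r m_gt0); lia.
  rewrite xS {1}xE !nth_flatten_iota // addn0.
  by have /(sortedP 0)/(_ _ xSp) := ps; lia.
- by case/andP: l_lt.
apply/forallP => b; apply/forallP => j.
have jm : j.+1 < m by have := ltn_ord j; lia.
by rewrite -addnS !nth_flatten_iota ?sp ?addnS // ltnW.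
Qed.

Lemma occurs_with_blocks n W : occurs_with m n W c = (n <= blocks 0 W).
Proof.
apply/occurs_withP/idP => [[p <- /starting_at_blocks //]|].
exact: blocks_starting_at.
Qed.

End Blocks.

(** Each separator 0 discards the partial block, so a part a contributes the integer quotient of a
    by m, independently of the others. *)
Lemma fact_contains_sum m n cs : (0 < m)%N ->
  fact_contains m n cs = (n <= sumn [seq a %/ m | a <- cs])%N.
Proof.
move=> m_gt0; rewrite /fact_contains occurs_with_blocks //; congr leq.
elim: cs => // a [|b cs] IH; rewrite /fword -/fword.
  by rewrite cats0 blocks_nseq //= add0n addn0.
by rewrite blocks_cat blocks_nseq // add0n map_cons /=
  -[X in _ = (_ + X)%N]/(sumn [seq (a %/ m)%N | a <- b :: cs]) -IH.
Qed.

(** * Cyclic avoidance in terms of rotations *)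

Lemma iter_rcyc (T : Type) j (W : seq T) : exists t, iter j rcyc W = rot t W.
Proof.
elim: j => [|j [t IH]]; first by exists 0%N; rewrite rot0.
rewrite iterS IH /rcyc /rotr size_rot.
have [ltW|leW] := leqP t (size W).
  by rewrite rot_add_mod ?leq_subr //; eexists.
by rewrite (rot_oversize (ltnW leW)); eexists.
Qed.

Lemma rot_iter_rcyc (T : Type) t (W : seq T) : exists j, rot t W = iter j rcyc W.
Proof.
have [ltW|leW] := leqP t (size W); last by exists 0%N; rewrite rot_oversize // ltnW.
exists (size W - t)%N.
have -> : rot t W = rotr (size W - t) W by rewrite /rotr subKn.
elim: (size W - t)%N (leq_subr t (size W)) => [|j IH] jW.
  by rewrite /rotr subn0 rot_size.
rewrite iterS -IH ?(ltnW jW) // {2}/rotr -(subnSK jW) rotS ?leq_subLR; last by lia.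
by rewrite /rcyc rotK.
Qed.

Lemma cyc_avoids_blocks m n (I : finType) (W : seq I) : (0 < m)%N ->
  cyc_avoids m n W <-> forall t c, (blocks m c 0 (rot t W) < n)%N.
Proof.
move=> m_gt0; split=> [cW t c|cW j].
  have [j ->] := rot_iter_rcyc t W; have := cW j; rewrite /contains negb_exists.
  by move/forallP/(_ c); rewrite occurs_with_blocks // ltnNge.
have [t ->] := iter_rcyc j W; rewrite /contains negb_exists.
by apply/forallP => c; rewrite occurs_with_blocks // -ltnNge.
Qed.

(** * Run-length encoding and rotations inside the first run *)

Section RunLength.
Variable I : finType.
Implicit Types (w : seq (I * nat)) (W : seq I) (i j : I).

Definition positive w := all (fun x => 0 < x.2)%N w.
Definition expand w := flatten [seq nseq x.2 x.1 | x <- w].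

Definition push i w :=
  if w is x :: w' then
    if x.1 == i then (i, x.2.+1) :: w' else (i, 1%N) :: w
  else [:: (i, 1%N)].
Definition rle W := foldr push [::] W.

Lemma expand_cons x w : expand (x :: w) = nseq x.2 x.1 ++ expand w.
Proof. by []. Qed.

Lemma expand_rcons x w : expand (rcons w x) = expand w ++ nseq x.2 x.1.
Proof. by rewrite /expand map_rcons flatten_rcons. Qed.

Lemma ohead_expand w i : positive w -> (ohead (expand w) == Some i) = starts i w.
Proof. by case: w => // -[a [|c]] w. Qed.

Lemma ohead_rev_expand w i :
  positive w -> (ohead (rev (expand w)) == Some i) = ends i w.
Proof.
case/lastP: w => // w [a [|c]]; rewrite /positive all_rcons //= => _.
by rewrite expand_rcons /ends map_rcons last_rcons rev_cat rev_nseq.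
Qed.

Lemma count_expand w i : count_mem i (expand w) = sumn (proj i w).
Proof.
elim: w => //= x w IH; rewrite expand_cons count_cat IH count_nseq proj_cons /=.
by case: eqP => _; rewrite ?mul1n ?mul0n.
Qed.

(** Adjacent letters of [w] differ and no run is empty, so runs of c never merge and each is counted
    on its own. *)
Lemma blocks_expand m c w : (0 < m)%N -> carlitz w -> positive w ->
  blocks m c 0 (expand w) = sumn [seq (a %/ m)%N | a <- proj c w].
Proof.
move=> m_gt0; elim: w => // x w IH; rewrite carlitz_cons => /andP[nst cw].
move=> /andP[x_gt0 pw]; rewrite expand_cons blocks_cat proj_cons.
case: eqVneq nst => [->|xc] nst; last first.
  by rewrite blocks_nseq_neq // pending_nseq_neq // IH.
by rewrite blocks_nseq // blocks_break ?IH // ohead_expand.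
Qed.

Lemma expand_push i w : expand (push i w) = i :: expand w.
Proof. by case: w => //= -[a c] w /=; case: eqP => [->|]. Qed.

Lemma positive_push i w : positive w -> positive (push i w).
Proof. by case: w => //= x w /andP[p1 p2]; case: ifP => //= _; rewrite p1. Qed.

Lemma carlitz_push i w : carlitz w -> carlitz (push i w).
Proof.
case: w => // -[a c] w cw; rewrite /push /=.
case: eqVneq cw => [<-|ai] cw; first by move: cw; rewrite !carlitz_cons.
by rewrite carlitz_cons cw /starts /= andbT; apply: contraNneq ai => -[->].
Qed.

Lemma expand_rle W : expand (rle W) = W.
Proof. by elim: W => //= a W IH; rewrite expand_push IH. Qed.

Lemma positive_rle W : positive (rle W).
Proof. by elim: W => //= a W; apply: positive_push. Qed.

Lemma carlitz_rle W : carlitz (rle W).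
Proof. by elim: W => //= a W; apply: carlitz_push. Qed.

Lemma rle_nseq_cat i a W : ~~ starts i (rle W) ->
  rle (nseq a.+1 i ++ W) = (i, a.+1) :: rle W.
Proof.
move=> nst; elim: a => [|a IH]; last first.
  by rewrite -[LHS]/(push i (rle (nseq a.+1 i ++ W))) IH /= eqxx.
rewrite -[LHS]/(push i (rle W)); case: (rle W) nst => // -[b c] w nst.
by rewrite /push /= ifN //; apply: contraNneq nst => ->; rewrite /starts eqxx.
Qed.

Lemma rle_expand w : carlitz w -> positive w -> rle (expand w) = w.
Proof.
elim: w => // -[i [//|a]] w IH; rewrite carlitz_cons => /andP[nst cw] /andP[_ pw].
by rewrite expand_cons rle_nseq_cat IH.
Qed.

Lemma positive_proj w : (forall j, all (ltn 0) (proj j w)) <-> positive w.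
Proof.
split=> [pw|/allP pw j].
  apply/allP => x xw; apply: (allP (pw x.1)); apply: map_f.
  by rewrite mem_filter eqxx.
by apply/allP => _ /mapP[x + ->]; rewrite mem_filter => /andP[_ /pw].
Qed.

(** The word [expand w] is one of its own rotations and, since its first and last letters differ, by
    [blocks_swap] it has the most blocks among them. So only this one word has to be tested. *)
Lemma cyc_avoids_expand m n w i o : (0 < m)%N ->
  carlitz w -> positive w -> starts i w -> ~~ ends i w ->
  cyc_avoids m n (rot o (expand w)) <->
  forall j, ~~ fact_contains m n (proj j w).
Proof.
move=> m_gt0 cw pw sw ew; rewrite cyc_avoids_blocks //; split=> [cW j|cW t c].
  rewrite fact_contains_sum // -ltnNge -blocks_expand //.
  have [t <-] : exists t, rot t (rot o (expand w)) = expand w.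
    by exists (size (rot o (expand w)) - o)%N; apply: rotK.
  exact: cW.
have [t' ->] : exists t', rot t (rot o (expand w)) = rot t' (expand w).
  have [lo|lo] := leqP o (size (expand w)); last first.
    by rewrite (rot_oversize (ltnW lo)); exists t.
  have [lt|lt] := leqP t (size (expand w)); last first.
    by rewrite rot_oversize ?size_rot 1?ltnW //; exists o.
  by rewrite rot_add_mod //; eexists.
have := cW c; rewrite fact_contains_sum // -ltnNge -blocks_expand //.
apply: leq_ltn_trans; rewrite -{2}(cat_take_drop t' (expand w)).
apply: blocks_swap => //; rewrite cat_take_drop.
by move: sw ew; rewrite -ohead_expand // -ohead_rev_expand // => /eqP->; rewrite eq_sym.
Qed.

(** For a nonconstant word this is the length, possibly zero, of the final stretch of letters i: the
    offset by which the first run was rotated. *)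
Definition trail i W := find (predC1 i) (rev W).

(** The inequality is strict because [W] adds at least one i to the run; this keeps an offset below
    the length of the first run. *)
Lemma rle_starts_nseq i b W : ohead W = Some i ->
  exists c w, (b < c)%N /\ rle (nseq b i ++ W) = (i, c) :: w.
Proof.
move=> hW; elim: b => [|b [c [w [bc E]]]]; last first.
  by exists c.+1, w; rewrite /= -/(rle _) E /= eqxx.
case: W hW => // a W [->] /=; rewrite -/(rle W).
case: (rle W) => [|[b c] w] /=; first by exists 1%N, [::].
by case: eqP => _; [exists c.+1, w | exists 1%N, ((b, c) :: w)].
Qed.

Lemma trailP i W : ohead W = Some i -> has (predC1 i) W ->
  exists Y, [/\ W = Y ++ nseq (trail i W) i, ohead Y = Some i
              & ohead (rev Y) != Some i].
Proof.
move=> hW nW; pose b := trail i W.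
have nW' : has (predC1 i) (rev W) by rewrite has_rev.
have revE : rev W = nseq b i ++ drop b (rev W).
  rewrite -{1}(cat_take_drop b (rev W)); congr (_ ++ _).
  have sz : size (take b (rev W)) = b.
    by rewrite size_take -has_find nW'.
  apply: (@eq_from_nth _ i); rewrite sz ?size_nseq // => x xb.
  rewrite nth_take // nth_nseq xb; apply/eqP.
  by have /negbT := before_find i xb; rewrite negbK.
have WE : W = rev (drop b (rev W)) ++ nseq b i.
  by rewrite -{1}[W]revK {1}revE rev_cat rev_nseq.
have dE : ohead (drop b (rev W)) != Some i.
  have bW : (b < size (rev W))%N by rewrite -has_find.
  rewrite (drop_nth i bW) /=; have := nth_find i nW'; rewrite /= -/b.
  by apply: contraNneq => -[->].
exists (rev (drop b (rev W))); split=> //; last by rewrite revK.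
have : rev (drop b (rev W)) != [::].
  rewrite -size_eq0 size_rev size_drop -lt0n subn_gt0 -has_find //.
by rewrite WE in hW; case: (rev _) hW.
Qed.

(** An offset o below the length l of the first run leaves l - o > 0 letters i in front and moves o
    of them behind a letter other than i, so o and [w] can be read off. Together with
    [rle_rotr_trail] this makes unrolling a bijection. *)
Lemma unroll_rot i w o : carlitz w -> positive w -> starts i w -> ~~ ends i w ->
  (o < head 0 (proj i w))%N ->
  let W := rot o (expand w) in
  [/\ ohead W = Some i, has (predC1 i) W, trail i W = o & rle (rotr o W) = w].
Proof.
move=> cw pw + ew oh /=; case: w cw pw ew oh => // -[a l] w cw pw ew oh.
rewrite /starts /= => /eqP[ai]; subst a.
rewrite proj_cons eqxx /= in oh.
have {}ew : ohead (rev (expand ((i, l) :: w))) != Some i by rewrite ohead_rev_expand.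
have rE : rot o (expand ((i, l) :: w)) = nseq (l - o) i ++ expand w ++ nseq o i.
  rewrite expand_cons /= -{1}(subnKC (ltnW oh)) nseqD -catA.
  by rewrite -{1}(size_nseq o i) rot_size_cat catA.
have eE : rev (expand ((i, l) :: w)) = rev (expand w) ++ nseq l i.
  by rewrite expand_cons rev_cat rev_nseq.
move: ew; rewrite eE.
(* If nothing followed the first run, the whole word would end with i. *)
case E: (rev (expand w)) => [|z Z] /= zi; first by case: (l) oh zi => //= ? _ /eqP.
rewrite rotK rle_expand // rE; split=> //.
- by rewrite -(subnSK oh).
- rewrite !has_cat -(has_rev _ (expand w)) E /=.
  by rewrite (_ : z != i) ?orbT //; apply: contraNneq zi => ->.
rewrite /trail catA rev_cat rev_nseq rev_cat E find_cat.
rewrite has_nseq /= eqxx andbF /= size_nseq.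
by rewrite (_ : z != i) ?addn0 //; apply: contraNneq zi => ->.
Qed.

Lemma rle_rotr_trail i W : ohead W = Some i -> has (predC1 i) W ->
  let w := rle (rotr (trail i W) W) in
  [/\ starts i w, ~~ ends i w & (trail i W < head 0 (proj i w))%N].
Proof.
move=> hW nW /=; have [Y [WE hY lY]] := trailP hW nW.
set b := trail i W in WE *.
have -> : rotr b W = nseq b i ++ Y by rewrite {1}WE -{1}(size_nseq b i) rotr_size_cat.
rewrite -ohead_expand ?positive_rle // -ohead_rev_expand ?positive_rle //.
rewrite expand_rle rev_cat; split.
- by case: (b) => [|?]; rewrite /= ?hY ?eqxx.
- case E: (rev Y) lY => //.
  by have := congr1 rev E; rewrite revK => Y0; rewrite Y0 in hY.
have [c [w [bc ->]]] := rle_starts_nseq b hY.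
by rewrite proj_cons eqxx.
Qed.

End RunLength.

(** * Coefficients of the generating functions *)

Section Factorizations.
Variables m n : nat.

Definition factorizations L : seq (seq nat) :=
  [seq map val (tval s) | p <- iota 0 L.+1,
     s <- [seq s : p.-tuple 'I_L.+1 <- enum {: p.-tuple 'I_L.+1} |
             [&& all (fun c => 0 < c)%N (map val s), sumn (map val s) == L
               & ~~ fact_contains m n (map val s)]]].

(** The bounds built into the enumeration are automatic: positive parts with sum L are at most L in
    number and in size. *)
Lemma mem_factorizations L s : (s \in factorizations L) =
  [&& all (fun c => 0 < c)%N s, sumn s == L & ~~ fact_contains m n s].
Proof.
apply/allpairsPdep/idP => [[p [t [_ + ->]]]|/[dup] sP /and3P[s_pos /eqP sL _]].
  by rewrite mem_filter => /andP[].
have size_s : (size s < L.+1)%N.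
  rewrite ltnS -sL; elim: (s) s_pos => //= a s' IH /andP[a0 /IH]; lia.
have s_lt : all (fun c => c < L.+1)%N s.
  apply/allP => c; rewrite ltnS -sL; elim: (s) => //= a s' IH.
  by rewrite inE => /orP[/eqP->|/IH]; lia.
have [t ts] : exists t : seq 'I_L.+1, map val t = s.
  elim: (s) s_lt => [_|x s' IH /= /andP[xL /IH[t <-]]]; first by exists [::].
  by exists (Ordinal xL :: t).
have tsz : size t == size s by rewrite -ts size_map.
exists (size s), (Tuple tsz); split; rewrite ?mem_iota ?ts //.
by rewrite mem_filter mem_enum /= ts sP.
Qed.

Lemma uniq_factorizations L : uniq (factorizations L).
Proof.
apply: allpairs_uniq_dep => [|p _|[p s] [p' s'] _ _ /=].
- exact: iota_uniq.
- exact/filter_uniq/enum_uniq.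
move=> E; have pp' : p = p'.
  by have := congr1 size E; rewrite !size_map !size_tuple.
subst p'; congr (Tagged _ _); apply: val_inj; exact: (inj_map val_inj).
Qed.

Lemma Hcoef_factorizations L :
  Hcoef m n L = \sum_(s <- factorizations L) ('X ^+ head 0%N s)%:P * 'X ^+ size s.
Proof.
rewrite /factorizations big_allpairs_dep /Hcoef -(big_mkord xpredT (fun p =>
  \sum_(s : p.-tuple 'I_L.+1 | [&& all (fun c => 0 < c)%N (map val s),
                sumn (map val s) == L & ~~ fact_contains m n (map val s)])
      ('X ^+ (head 0%N (map val s)))%:P * 'X ^+ p)).
rewrite /index_iota subn0; apply: eq_bigr => p _.
rewrite big_filter big_enum_cond /=; apply: eq_bigr => s _.
by rewrite size_map size_tuple.
Qed.

Lemma coef_Hcoef L p : (Hcoef m n L)`_p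
  = \sum_(s <- factorizations L | size s == p) 'X ^+ head 0%N s.
Proof.
rewrite Hcoef_factorizations coef_sum [RHS]big_mkcond; apply: eq_bigr => s _.
by rewrite coefCM coefXn eq_sym; case: eqP; rewrite ?mulr1 ?mulr0.
Qed.

Lemma Tmap_Hcoef1 L : Tmap (Hcoef1 m n L) = \sum_(s <- factorizations L) lag (size s).
Proof.
suff -> : Hcoef1 m n L = \sum_(s <- factorizations L) 'X^(size s).
  by rewrite raddf_sum; apply: eq_bigr => s _; rewrite -TmapXn.
apply/polyP => p; rewrite coef_map_id0 ?horner0 // coef_Hcoef coef_sum.
rewrite horner_sum [LHS]big_mkcond; apply: eq_bigr => s _.
by rewrite coefXn eq_sym hornerXn expr1n; case: eqP.
Qed.

Lemma Tmap_Dcoef L : Tmap (Dcoef m n L)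
  = \sum_(s <- factorizations L) lag (size s) *+ size s *+ head 0%N s.
Proof.
suff -> : Dcoef m n L = \sum_(s <- factorizations L) 'X^(size s) *+ size s *+ head 0%N s.
  by rewrite raddf_sum; apply: eq_bigr => s _; rewrite !raddfMn -TmapXn.
apply/polyP => p; rewrite /Dcoef coefXM.
have -> (q : {poly {poly rat}}) : (if p == 0%N then 0 else
    (map_poly (fun q => q.[1]) (map_poly (fun q => q^`()) q^`()))`_p.-1)
    = (q`_p)^`().[1] *+ p.
  case: p => [|p]; first by rewrite mulr0n.
  rewrite /= coef_map_id0 ?horner0 // coef_map_id0 ?deriv0 // coef_deriv.
  by rewrite derivMn hornerMn.
rewrite coef_Hcoef coef_sum raddf_sum /= horner_sum -sumrMnl [LHS]big_mkcond.
apply: eq_bigr => s _; rewrite !coefMn coefXn derivXn hornerMn hornerXn expr1n.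
by rewrite [p == _]eq_sym; case: eqP => [->|_]; rewrite ?mul0rn // mulrnAC.
Qed.

Lemma Tmap_Hcoef10 : (0 < m)%N -> (0 < n)%N -> Tmap (Hcoef1 m n 0) = 1.
Proof.
move=> m_gt0 n_gt0; rewrite Tmap_Hcoef1 (perm_big [:: [::]]) ?big_seq1 ?lag0 //=.
apply: uniq_perm => [||s]; rewrite ?uniq_factorizations // mem_factorizations inE.
rewrite fact_contains_sum //; case: s => [|[|a] s] //=.
  by rewrite -ltnNge n_gt0.
by rewrite andbF.
Qed.

End Factorizations.

Lemma prod_sum_seq (I : finType) (K : choiceType) (R : comNzRingType) (F : I -> seq K) :
  (forall i, uniq (F i)) ->
  exists r : seq {ffun I -> K},
    [/\ uniq r, (forall f, f \in r <-> forall i, f i \in F i)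
      & forall G : I -> K -> R,
          \prod_i \sum_(x <- F i) G i x = \sum_(f <- r) \prod_i G i (f i)].
Proof.
(* [K] may be infinite; the entries of all the lists form a finite type, over which a product of
   sums can be distributed. *)
move=> uF; pose fT : finType := seq_sub (flatten [seq F i | i <- enum I]).
have inF i x : x \in F i -> x \in flatten [seq F i | i <- enum I].
  by move=> xF; apply/flatten_mapP; exists i; rewrite ?mem_enum.
pose Q i := [pred y : fT | val y \in F i].
exists [seq [ffun i => val (f i)] | f : {ffun I -> fT} <- enum (family Q)]; split.
- rewrite map_inj_uniq ?enum_uniq // => f g /ffunP fg; apply/ffunP => i.
  by apply: val_inj; have := fg i; rewrite !ffunE.
- move=> f; split=> [/mapP[g + -> i]|fF].
    by rewrite mem_enum => /familyP/(_ i); rewrite ffunE.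
  apply/mapP; exists [ffun i => SeqSub (inF i _ (fF i))].
    by rewrite mem_enum; apply/familyP => i; rewrite ffunE inE /=.
  by apply/ffunP => i; rewrite !ffunE.
move=> G; rewrite big_map big_enum /=.
transitivity (\prod_i \sum_(y : fT | Q i y) G i (val y)); last first.
  rewrite bigA_distr_big_dep; apply: eq_bigr => f _.
  by apply: eq_bigr => i _; rewrite ffunE.
apply: eq_bigr => i _.
rewrite (perm_big [seq val y | y : fT <- enum (Q i)]); last first.
  apply: uniq_perm => // [|x].
    by rewrite map_inj_uniq ?enum_uniq //; apply: val_inj.
  apply/idP/mapP => [xF|[y + ->]]; last by rewrite mem_enum.
  by exists (SeqSub (inF i x xF)); rewrite ?mem_enum.
by rewrite big_map big_enum.
Qed.

(** Each factor involves its own variable only, so a single choice of exponents yields the monomial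
    e, and the bound N leaves it in range. *)
Lemma mcoeff_prod_sumX (R : comNzRingType) k N (c : 'I_k -> nat -> R) (e : 'X_{1..k}) :
  (forall j, e j <= N)%N ->
  (\prod_j \sum_(a < N.+1) c j a *: 'X_j ^+ a : {mpoly R[k]})@_e = \prod_j c j (e j).
Proof.
move=> eN; rewrite bigA_distr_bigA raddf_sum /=.
have cX (f : {ffun 'I_k -> 'I_N.+1}) :
    (\prod_i (c i (f i) *: 'X_i ^+ f i) : {mpoly R[k]})@_e
    = \prod_i c i (f i) * ([multinom val (f i) | i < k] == e)%:R.
  rewrite scaler_prod mcoeffZ -mcoeffX mpolyXE_id; congr (_ * mcoeff _ _).
  by apply: eq_bigr => i _; rewrite mnmE.
rewrite (eq_bigr _ (fun f _ => cX f)) (bigD1 [ffun j => inord (e j)]) //=.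
rewrite [X in _ + X]big1 ?addr0 => [|f fe].
  rewrite (_ : _ == e) ?mulr1; last first.
    by apply/eqP/mnmP => j; rewrite mnmE ffunE /= inordK // ltnS.
  by apply: eq_bigr => j _; rewrite ffunE inordK // ltnS.
case: eqP => [E|_]; last by rewrite mulr0.
case/eqP: fe; apply/ffunP => j; rewrite ffunE; apply: val_inj.
by rewrite /= -E mnmE inordK.
Qed.

(** * Words with prescribed letter multiplicities *)

Section Content.
Variables m n k : nat.
Hypotheses (m_gt0 : (0 < m)%N) (n_gt0 : (0 < n)%N).
Implicit Types (W : seq 'I_k) (e : 'X_{1..k}).

Definition content W : 'X_{1..k} := [multinom count_mem i W | i < k].

Lemma contentP W e : content W = e <-> forall i, count_mem i W = e i.
Proof.
by split=> [<- i|We]; [rewrite mnmE | apply/mnmP => i; rewrite mnmE].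
Qed.

Lemma mdeg_content W : mdeg (content W) = size W.
Proof.
rewrite mdegE; under eq_bigr => i _ do rewrite mnmE.
elim: W => [|a W IH] /=; first by rewrite big1.
rewrite big_split /= IH (bigD1 a) //= eqxx big1 // => i.
by rewrite eq_sym => /negPf->.
Qed.

(** The coefficient of x^e in the i-th summand before division by t and [Phi]; the last product is
    the coefficient contributed by the constant -1, up to sign. *)
Definition rhs_start (e : 'X_{1..k}) (i : 'I_k) : {poly rat} :=
  Tmap (Dcoef m n (e i)) *
    (\prod_(j | j != i) Tmap (Hcoef1 m n (e j)) - \prod_(j | j != i) (e j == 0%N)%:R).

Lemma mcoeff_map_Phi_tinv e (p : {mpoly {poly rat}[k]}) :
  (map_mpoly (fun q => Phi (tinv q)) p)@_e = Phi (tinv p@_e).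
Proof. exact: (@mcoeff_map_mpoly k _ _ (Phi \o tinv)). Qed.

Lemma mcoeff_rhs e : (rhs m n k (mdeg e))@_e
  = (e == 0%MM)%:R + \sum_i Phi (tinv (rhs_start e i))
    + \sum_i \sum_(1 <= a < m * n) ((U_(i) *+ a)%MM == e)%:R.
Proof.
have eN j : (e j <= mdeg e)%N by rewrite mdegE (bigD1 j) ?leq_addr.
rewrite /rhs !mcoeffD mcoeff1 !raddf_sum /=; congr (_ + _ + _); last first.
  apply: eq_bigr => i _; rewrite raddf_sum; apply: eq_bigr => a _ /=.
  by rewrite mpolyXn mcoeffX.
apply: eq_bigr => i _; rewrite mcoeff_map_Phi_tinv; congr (Phi (tinv _)).
rewrite mulrDr mulrN1 addrC mcoeffB /rhs_start mulrBr.
(* The factor of the letter i is merged with the others, so that the product runs over all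
   variables. *)
pose c (d : 'I_k -> nat -> {poly rat}) j :=
    if j == i then fun a => Tmap (Dcoef m n a) else d j.
have cE (d : 'I_k -> nat -> {poly rat}) : TDx m n (mdeg e) i
      * (\prod_(j | j != i) \sum_(a < (mdeg e).+1) d j a *: 'X_j ^+ a)
    = \prod_j \sum_(a < (mdeg e).+1) c d j a *: 'X_j ^+ a.
  rewrite [RHS](bigD1 i) //= /c eqxx; congr (_ * _).
  by apply: eq_bigr => j /negPf ji; rewrite ji.
have cP (d : 'I_k -> nat -> {poly rat}) : \prod_j c d j (e j)
    = Tmap (Dcoef m n (e i)) * \prod_(j | j != i) d j (e j).
  rewrite (bigD1 i) //= /c eqxx; congr (_ * _).
  by apply: eq_bigr => j /negPf ji; rewrite ji.
congr (_ - _).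
  by rewrite (cE (fun _ a => Tmap (Hcoef1 m n a))) mcoeff_prod_sumX // cP.
(* The constant 1 is written as a product of series in the variables other than x_i, each with
   constant term 1 and nothing else. *)
have := cE (fun _ a => (a == 0%N)%:R); rewrite [X in _ * X = _]big1 => [|j _].
  by rewrite mulr1 => ->; rewrite mcoeff_prod_sumX // cP.
rewrite big_ord_recl /= scale1r expr0 big1 ?addr0 // => a _.
by rewrite scale0r.
Qed.

Definition word_of i e W : Prop :=
  [/\ cyc_avoids m n W, forall j, count_mem j W = e j,
      ohead W = Some i & has (predC1 i) W].

Lemma counts_word_of i e : counts (word_of i e) (Phi (tinv (rhs_start e i))).
Proof.
(* If only i may occur, the two products in [rhs_start] are both 1 and cancel, and no word contains
   a second letter. Otherwise the product coming from -1 vanishes. *)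
have [/forallP e0|] := boolP [forall j, (j != i) ==> (e j == 0%N)].
  have -> : rhs_start e i = 0.
    rewrite /rhs_start !big1 ?subrr ?mulr0 // => j ji.
      by have /implyP/(_ ji)-> := e0 j.
    by have /implyP/(_ ji)/eqP-> := e0 j; rewrite Tmap_Hcoef10.
  rewrite !raddf0; apply: counts0 => W [_ We _ /hasP[j jW ji]].
  have /implyP/(_ ji) := e0 j; rewrite -We => /eqP/count_memPn.
  by rewrite jW.
rewrite negb_forall => /existsP[j]; rewrite negb_imply => /andP[ji ej].
have -> : rhs_start e i = \prod_j \sum_(s <- factorizations m n (e j))
    (if j == i then lag (size s) *+ size s *+ head 0%N s else lag (size s)).
  rewrite /rhs_start [X in _ - X](bigD1 j) //= (negPf ej) mul0r subr0.
  rewrite [RHS](bigD1 i) //= eqxx Tmap_Dcoef; congr (_ * _).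
  by apply: eq_bigr => j' /negPf->; rewrite Tmap_Hcoef1.
have [r [ur rP ->]] := prod_sum_seq {poly rat} (fun j => uniq_factorizations m n (e j)).
rewrite !raddf_sum /=.
(* For a fixed factorization of every letter, the Carlitz words are counted by
   [counts_cyclic_carlitz]; the offsets contribute the length of the first run, which is the factor
   produced by the derivative in v. *)
have cf f : f \in r -> counts
    (fun x : seq ('I_k * nat) * nat =>
       ((carlitz_for f x.1 /\ starts i x.1) /\ ~~ ends i x.1)
       /\ (x.2 < head 0 (f i))%N)
    (Phi (tinv (\prod_j (if j == i
       then lag (size (f j)) *+ size (f j) *+ head 0%N (f j)
       else lag (size (f j)))))).
  move=> /rP fr; have fj : f j <> [::].
    move=> fj; have := fr j; rewrite mem_factorizations fj /= => /andP[/eqP e0].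
    by rewrite -e0 eqxx in ej.
  have := counts_pairs (head 0%N (f i)) (counts_cyclic_carlitz ji fj).
  rewrite [X in _ -> counts _ (Phi (tinv X))](bigD1 i) //= eqxx -raddfMn -mulrnAl.
  congr (counts _ (Phi _)).
  rewrite [X in _ = tinv (_ * X)](eq_bigr (fun j => lag (size (f j))));
    last by move=> j' /negPf->.
  by rewrite -mulX_clag -mulrnAr -mulrA tinv_mulX.
have posP f w : f \in r -> carlitz_for f w ->
    positive w /\ forall j, ~~ fact_contains m n (proj j w) /\ sumn (proj j w) = e j.
  move=> /rP fr [_ pw]; have {}fr j' := fr j'.
  have {}fr j' : [&& all (fun c => 0 < c)%N (proj j' w), sumn (proj j' w) == e j'
      & ~~ fact_contains m n (proj j' w)] by rewrite pw -mem_factorizations.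
  split=> [|j']; last by have /and3P[_ /eqP-> ->] := fr j'.
  by apply/positive_proj => j'; have /and3P[] := fr j'.
apply: (@counts_bij _ _ _ _ (fun x => rot x.2 (expand x.1))
  (fun W => (rle (rotr (trail i W) W), trail i W)) _ _ _ (counts_bigU ur cf _)).
- move=> [w o] [f fr [[[/= cf' sw] ew] oh]].
  have [pw wP] := posP f w fr cf'; have [cw pf] := cf'.
  rewrite -pf in oh; have [hW nW tW rW] := unroll_rot cw pw sw ew oh.
  split; last by rewrite tW rW.
  split=> // [|j']; last first.
    rewrite (permP (_ : perm_eq _ (expand w))) ?perm_rot // count_expand.
    by have [] := wP j'.
  by apply/(cyc_avoids_expand n o m_gt0 cw pw sw ew) => j'; have [] := wP j'.
- move=> W [cW We hW nW]; have [sw ew tw] := rle_rotr_trail hW nW.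
  set w := rle _ in sw ew tw *; have EW : rot (trail i W) (expand w) = W.
    by rewrite expand_rle rotrK.
  have [cw pw] : carlitz w /\ positive w.
    by split; [apply: carlitz_rle | apply: positive_rle].
  split; last exact: EW.
  exists [ffun j => proj j w]; last first.
    split; last by rewrite ffunE.
    by do 2![split=> //]; split=> // j'; rewrite ffunE.
  apply/rP => j'; rewrite ffunE mem_factorizations; apply/and3P; split.
  + by have /positive_proj := pw; apply.
  + rewrite -count_expand -We -EW.
    by rewrite (permP (_ : perm_eq (rot _ _) (expand w))) ?perm_rot.
  by move: j'; apply/(cyc_avoids_expand n (trail i W) m_gt0 cw pw sw ew); rewrite EW.
- move=> f g [w o] [[[[_ fw] _] _] _] [[[[_ gw] _] _] _].
  by apply/ffunP => j'; rewrite -fw gw.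
Qed.

Lemma cyc_avoids_nil : cyc_avoids m n ([::] : seq 'I_k).
Proof. by apply/cyc_avoids_blocks => // t c. Qed.

Lemma rot_nseq (T : Type) t a (x : T) : rot t (nseq a x) = nseq a x.
Proof.
have [lt|lt] := leqP t a; last by rewrite rot_oversize ?size_nseq // ltnW.
rewrite -{1}(subnKC lt) nseqD -{1}(size_nseq t x) rot_size_cat -nseqD.
by rewrite subnK.
Qed.

Lemma cyc_avoids_nseq a (i : 'I_k) : cyc_avoids m n (nseq a i) <-> (a < m * n)%N.
Proof.
rewrite cyc_avoids_blocks // mulnC -ltn_divLR //; split=> [/(_ 0%N i)|a_lt t c].
  by rewrite rot0 blocks_nseq.
rewrite rot_nseq; have [->|ic] := eqVneq i c; first by rewrite blocks_nseq.
by rewrite blocks_nseq_neq.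
Qed.

Lemma counts_nseq e a (i : 'I_k) :
  counts (fun W => W = nseq a i /\ content W = e) ((U_(i) *+ a)%MM == e)%:R.
Proof.
have -> : (U_(i) *+ a)%MM = content (nseq a i).
  by apply/mnmP => j; rewrite mulmnE mnm1E mnmE count_nseq.
case: eqP => [<-|ne]; last by apply: counts0 => _ [-> /ne].
by apply: (counts1 (a := nseq a i)) => W; split=> [[]|->].
Qed.

(** The three terms of the right side count the empty word, the nonconstant words sorted by first
    letter, and the nonempty constant words. *)
Lemma counts_content e :
  counts (fun W => cyc_avoids m n W /\ forall i, count_mem i W = e i)
    (rhs m n k (mdeg e))@_e.
Proof.
rewrite mcoeff_rhs.
have c0 := counts1 (P := fun W => W = [::] :> seq 'I_k) (fun W => iff_refl _).
have {}c0 : counts (fun W => W = [::] /\ content W = e) ((e == 0%MM)%:R).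
  have <- : content [::] = 0%MM by apply/eqP; rewrite -mdeg_eq0 mdeg_content.
  rewrite eq_sym; case: eqP => [<-|ne]; last by apply: counts0 => _ [-> /ne].
  by apply: counts_ext c0 => W; split=> [->|[]].
have c1 : counts (fun W => exists2 i, i \in index_enum 'I_k & word_of i e W)
    (\sum_i Phi (tinv (rhs_start e i))).
  apply: counts_bigU (index_enum_uniq _) (fun i _ => counts_word_of i e) _.
  by move=> i j W [_ _ + _] [_ _ + _] => -> [].
have c2 : counts (fun W => exists2 i, i \in index_enum 'I_k &
      exists2 a, a \in index_iota 1 (m * n) & W = nseq a i /\ content W = e)
    (\sum_i \sum_(1 <= a < m * n) ((U_(i) *+ a)%MM == e)%:R).
  apply: counts_bigU (index_enum_uniq _) _ _ => [i _|i j W].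
    apply: counts_bigU (iota_uniq _ _) (fun a _ => counts_nseq e a i) _.
    by move=> a b W [-> _] [/(congr1 size) + _]; rewrite !size_nseq.
  move=> [a + [-> _]] [b + [+ _]]; rewrite !mem_index_iota.
  by case: a b => // a [|b] // _ _ [].
apply: counts_ext (counts_add (counts_add c0 c1 _) c2 _).
- move=> W; split.
    case=> [[[-> <-]|[i _ [cW We _ _]]]|[i _ [a + [-> /contentP We]]]].
    + by split=> [|i]; [apply: cyc_avoids_nil | rewrite mnmE].
    + by split.
    by rewrite mem_index_iota => /andP[_ amn]; split=> //; apply/cyc_avoids_nseq.
  move=> [cW /[dup] We' /contentP We]; case E: W => [|i W'].
    by left; left; split=> //; rewrite -E.
  rewrite -E; have [nW|] := boolP (has (predC1 i) W).
    by left; right; exists i; rewrite ?mem_index_enum //; split=> //; rewrite E.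
  rewrite has_predC negbK => /all_pred1P WE.
  right; exists i; rewrite ?mem_index_enum //; exists (size W); last by split.
  rewrite mem_index_iota; apply/andP; split; first by rewrite E.
  by apply/(cyc_avoids_nseq _ i); rewrite -WE.
- by move=> W [-> _] [i _ [_ _]].
move=> W [[-> _]|[i _ [_ _ hW nW]]] [j _ [a + [WE _]]]; rewrite mem_index_iota.
  by case: a WE.
case: a WE => // a WE _; move: hW nW; rewrite WE /= => -[->].
by rewrite eqxx has_nseq /= eqxx andbF.
Qed.

Lemma counts_size N M : (N < M)%N ->
  counts (fun W => cyc_avoids m n W /\ size W = N)
    (\sum_(e : 'X_{1..k < M} | mdeg e == N) (rhs m n k N)@_e).
Proof.
move=> NM; have c (e : 'X_{1..k < M}) :
    e \in [seq e : 'X_{1..k < M} <- index_enum _ | mdeg e == N] ->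
    counts (fun W => cyc_avoids m n W /\ forall i, count_mem i W = e i)
      (rhs m n k N)@_e.
  by rewrite mem_filter => /andP[/eqP <- _]; apply: counts_content.
have := counts_bigU (filter_uniq _ (index_enum_uniq _)) c.
rewrite big_filter; move=> cU; apply: counts_ext (cU _) => [W|e f W].
  split=> [[e + [cW /contentP We]]|[cW sW]].
    by rewrite mem_filter => /andP[/eqP <- _]; rewrite -We mdeg_content.
  have eM : (mdeg (content W) < M)%N by rewrite mdeg_content sW.
  exists (BMultinom eM).
    by rewrite mem_filter /= mdeg_content sW eqxx mem_index_enum.
  by split=> // i; rewrite mnmE.
by move=> [_ /contentP We] [_ /contentP Wf]; apply: val_inj; rewrite /= -We.
Qed.

End Content.

(** * Setting all variables equal *)

Section Specialization.
Variable k : nat.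

Definition univariate (R : comNzRingType) : {mpoly R[k]} -> {poly R} :=
  mmap polyC (fun=> 'X).

HB.instance Definition _ (R : comNzRingType) := GRing.RMorphism.on (@univariate R).

Lemma coef_univariate (R : comNzRingType) M (p : {mpoly R[k]}) N : (msize p <= M)%N ->
  (univariate p)`_N = \sum_(e : 'X_{1..k < M} | mdeg e == N) p@_e.
Proof.
move=> pM; rewrite /univariate (mmapE M) // coef_sum [RHS]big_mkcond.
apply: eq_bigr => e _; rewrite coefCM /mmap1 prodrXr -mdegE coefXn eq_sym.
by case: eqP; rewrite ?mulr1 ?mulr0.
Qed.

Lemma univariateZX (R : comNzRingType) (c : R) i a :
  univariate (c *: 'X_i ^+ a) = c *: 'X^a.
Proof. by rewrite /univariate mmapZ rmorphXn /= mmapX mmap1U mul_polyC. Qed.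

(** Division by t followed by [Phi] is additive but not multiplicative, so the commutation is
    checked on coefficients, with one bound valid for both polynomials. *)
Lemma univariate_map (p : {mpoly {poly rat}[k]}) :
  univariate (map_mpoly (fun q => Phi (tinv q)) p)
  = map_poly (fun q => Phi (tinv q)) (univariate p).
Proof.
apply/polyP => N; set p' := map_mpoly _ p; pose M := maxn (msize p) (msize p').
rewrite coef_map_id0 ?raddf0 // !(@coef_univariate _ M) ?leq_maxl ?leq_maxr //.
by rewrite !raddf_sum; apply: eq_bigr => e _; rewrite mcoeff_map_Phi_tinv.
Qed.

Lemma univariate_rhs m n N : univariate (rhs m n k N) = rhs1 m n k N.
Proof.
have uTH j : univariate (THx m n N j) = THx1 m n N.
  by rewrite raddf_sum; apply: eq_bigr => a _; rewrite /= univariateZX.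
have uTD i : univariate (TDx m n N i) = TDx1 m n N.
  by rewrite raddf_sum; apply: eq_bigr => a _; rewrite /= univariateZX.
have nk (V : nmodType) (x : V) : x *+ k = \sum_(i < k) x by rewrite sumr_const card_ord.
rewrite /rhs /rhs1 !scaler_nat !nk !rmorphD rmorph1 /=
  ![univariate (\sum_(i < k) _)]raddf_sum /=.
congr (_ + _ + _).
  apply: eq_bigr => i _; rewrite univariate_map rmorphM rmorphD rmorphN1
    rmorph_prod /= uTD.
  rewrite addrC; congr (map_poly _ (_ * (_ - 1))).
  rewrite (eq_bigr _ (fun j _ => uTH j)) prodr_const; congr (_ ^+ _).
  by rewrite -[in RHS](card_ord k) -(cardC1 i); apply: eq_card.
apply: eq_bigr => i _; rewrite raddf_sum; apply: eq_bigr => a _.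
by rewrite /= -[X in univariate X]scale1r univariateZX scale1r.
Qed.

End Specialization.

Theorem theorem5p2 (m n k : nat) :
  (0 < m)%N -> (0 < n)%N -> (0 < k)%N ->
  (* coefficient of x^e, for every monomial e in x_1..x_k *)
  (forall e : 'X_{1..k},
     exists Ws : seq (seq 'I_k),
       [/\ uniq Ws,
           (forall W : seq 'I_k,
              W \in Ws <-> (cyc_avoids m n W /\ forall i : 'I_k, count_mem i W = e i))
         & (size Ws)%:R = (rhs m n k (mdeg e))@_e])
  /\
  (* coefficient of x^N in the specialization x_i = x *)
  (forall N : nat,
     exists Ws : seq (seq 'I_k),
       [/\ uniq Ws,
           (forall W : seq 'I_k, W \in Ws <-> (cyc_avoids m n W /\ size W = N))
         & (size Ws)%:R = (rhs1 m n k N)`_N]).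
Proof.
move=> m_gt0 n_gt0 _; split=> [e|N]; first exact: counts_content.
(* The bound must cover all monomials of [rhs] for the specialization, and all monomials of degree N
   for the count. *)
pose M := maxn (msize (rhs m n k N)) N.+1.
rewrite -univariate_rhs (@coef_univariate _ _ M) ?leq_maxl //.
by apply: counts_size => //; rewrite leq_maxr.
Qed.
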